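(* There exists an absolute constant $c>0$ such that for every $\Delta$ there is a bipartite $\Delta$-bounded graph sequence $\mathcal{F}=\{F_1,F_2,\ldots\}$ and there is a $2$-edge-coloring of a complete graph $K_n$ (for some $n$) such that any covering of the vertices of $K_n$ by vertex-disjoint monochromatic copies of graphs from $\mathcal{F}$ uses at least $2^{c\Delta}$ such copies.
   Context: A sequence $\mathcal{F}=\{F_1,F_2,\ldots\}$ of graphs is $\Delta$-bounded if for every $n$, $F_n$ is a graph on exactly $n$ vertices with maximum degree at most $\Delta$; it is bipartite if every $F_n$ is bipartite. A monochromatic copy of a graph $F$ in an edge-colored complete graph is a subgraph isomorphic to $F$ all of whose edges have the same color. *)

(* Defs.v *)
From mathcomp Require Import all_boot all_order all_algebra.
From mathcomp Require Import reals exp.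

Set Implicit Arguments.
Unset Strict Implicit.
Unset Printing Implicit Defensive.

Record sgraph (T : finType) := SGraph {
  adj :> rel T;
  adj_sym : symmetric adj;
  adj_irr : irreflexive adj
}.

Section Graphs.
Variable T : finType.
Implicit Type G : sgraph T.

Definition edge_set G : {set {set T}} :=
  [set [set p.1; p.2] | p : T * T & G p.1 p.2].

Definition degree G (x : T) : nat := #|[set y | G x y]|.

Definition max_degree G : nat := \max_(x : T) degree G x.

Definition bipartite G : Prop :=
  exists side : T -> bool, forall x y, G x y -> side x != side y.

End Graphs.

(* F n is the graph F_n, with vertex set 'I_n.  Sequences start at F_1; the
   term F 0 (necessarily the empty graph) is a dummy that [covering] excludes,
   so that every copy has at least one vertex. *)
Definition graph_seq := forall n : nat, sgraph 'I_n.

Definition bounded_seq (Delta : nat) (F : graph_seq) : Prop :=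
  forall n, max_degree (F n) <= Delta.

Definition bipartite_seq (F : graph_seq) : Prop :=
  forall n, bipartite (F n).

(* A subgraph of the complete graph on V is the pair (vertex set, edge set),
   an edge being a two-element set of vertices. *)
Notation subgraph V := ({set V} * {set {set V}})%type.

Definition is_copy (T V : finType) (G : sgraph T) (H : subgraph V) : Prop :=
  exists f : T -> V,
    [/\ injective f,
        H.1 = [set f x | x : T]
      & H.2 = [set f @: (e : {set T}) | e in edge_set G]].

(* A 2-edge-coloring of the complete graph on V is a function
   chi : {set V} -> bool; only its values on two-element sets are ever used. *)
Definition monochromatic (V : finType) (chi : {set V} -> bool)
    (H : subgraph V) : Prop :=
  exists b : bool, forall e, e \in H.2 -> chi e = b.

Definition covering (F : graph_seq) (V : finType) (chi : {set V} -> bool)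
    (C : {set subgraph V}) : Prop :=
  [/\ forall H, H \in C ->
        monochromatic chi H /\ exists2 k, 0 < k & is_copy (F k) H,
      forall H1 H2, H1 \in C -> H2 \in C -> H1 != H2 -> [disjoint H1.1 & H2.1]
    & \bigcup_(H in C) H.1 = [set: V]].

(* Main.v *)
(** A monochromatic copy of [F_k] with [k >= 2 Delta], where [F_k] is
    [K_{Delta,Delta}] plus isolated vertices, contains a monochromatic
    [K_{Delta,Delta}].  A random coloring of the complete graph on
    [N = 2 ^ ((Delta - 1) / 2)] vertices contains none, so every copy used in a
    covering has fewer than [2 Delta] vertices, and at least [N / (2 Delta)]
    copies are needed.  For small [Delta > 0], where this bound is vacuous, the
    same reasoning applies to two disjoint edges in [K_4] colored as a star and
    its complementary triangle. *)
Require Import Defs.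
From mathcomp Require Import all_boot all_order all_algebra.
From mathcomp Require Import reals exp.
From mathcomp Require Import zify.

Import Order.TTheory GRing.Theory Num.Theory.

Set Implicit Arguments.
Unset Strict Implicit.
Unset Printing Implicit Defensive.

Definition mono_free (T V : finType) (G : sgraph T) (chi : {set V} -> bool) :=
  forall H, is_copy G H -> ~ monochromatic chi H.

Section Padding.
Variables (m : nat) (G : sgraph 'I_m).

(** [insub] covers both regimes: for [k >= m] the graph is [G] with isolated vertices added, for
    [k < m] it is [G] induced on its first [k] vertices. *)
Definition pad_rel k : rel 'I_k := fun x y =>
  if (insub (val x), insub (val y)) is (Some u, Some v) then G u v else false.

Lemma pad_sym k : symmetric (@pad_rel k).
Proof.
move=> x y; rewrite /pad_rel.
by case: (insub _) => [u|]; case: (insub _) => [v|] //; apply: adj_sym.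
Qed.

Lemma pad_irr k : irreflexive (@pad_rel k).
Proof. by move=> x; rewrite /pad_rel; case: (insub _) => // u; apply: adj_irr. Qed.

Definition pad : graph_seq := fun k => SGraph (@pad_sym k) (@pad_irr k).

Lemma pad_bounded Delta : max_degree G <= Delta -> bounded_seq Delta pad.
Proof.
move=> leG k; apply/bigmax_leqP => x _.
rewrite /degree /= /pad_rel; case: (insub _) => [u|]; last first.
  by rewrite (_ : [set _ | _] = set0) ?cards0 //; apply/setP => y; rewrite !inE.
apply: leq_trans leG; apply: leq_trans (leq_bigmax u); rewrite /degree.
set A : {set 'I_k} := [set _ | _].
have insubA y : y \in A -> exists2 v : 'I_m, val v = val y & G u v.
  by rewrite inE; case: (@insubP _ _ 'I_m (val y)) => // v _ vy Guv; exists v.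
(* The default [u] of [insubd] is never taken on [A], whose members all have value below [m]; hence
   this map is injective on [A]. *)
rewrite -(@card_in_imset _ _ (fun y : 'I_k => insubd u (val y)) A).
  apply/subset_leq_card/subsetP => _ /imsetP[y /insubA[v vy Guv] ->].
  by rewrite inE -vy valKd.
move=> y z /insubA[v vy _] /insubA[w wz _].
by rewrite -vy -wz !valKd => vw; apply: val_inj; rewrite -vy -wz vw.
Qed.

Lemma pad_bipartite : bipartite G -> bipartite_seq pad.
Proof.
move=> [side sideG] k.
exists (fun x => oapp side false (insub (val x))) => x y /=; rewrite /pad_rel.
by case: (insub _) => [u|]; case: (insub _) => [v|] //=; apply: sideG.
Qed.

(** If [k >= m], the first [m] vertices of a monochromatic copy of [pad k] span a copy of [G] in the
    same color. *)
Lemma pad_copy_small (V : finType) (chi : {set V} -> bool) k (H : subgraph V) :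
  mono_free G chi -> is_copy (pad k) H -> monochromatic chi H -> #|H.1| < m.
Proof.
move=> freeG [f [injf H1 H2]] [b monoH].
rewrite H1 card_imset // card_ord ltnNge; apply/negP => le_mk.
pose g u := f (widen_ord le_mk u).
have injg : injective g by move=> u v /injf/(congr1 val)/= /val_inj.
apply: (freeG ([set g u | u : 'I_m], [set g @: (e : {set _}) | e in edge_set G])).
  by exists g.
exists b => e /imsetP[_ /imsetP[[u v] /[!inE]/= Guv ->] ->].
apply: monoH; rewrite H2; apply/imsetP.
exists [set widen_ord le_mk u; widen_ord le_mk v]; last by rewrite !imsetU1 !imset_set1.
apply/imsetP; exists (widen_ord le_mk u, widen_ord le_mk v) => //.
by rewrite inE /= /pad_rel /= !valK.
Qed.

Lemma pad_covering (V : finType) (chi : {set V} -> bool) (C : {set subgraph V}) :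
  mono_free G chi -> covering pad chi C -> #|V| <= #|C| * m.-1.
Proof.
move=> freeG [copyC _ coverC].
rewrite -cardsT -coverC -sum_nat_const.
apply: leq_trans (_ : \sum_(H in C) #|H.1| <= _).
  apply: (big_ind2 (fun (A : {set V}) n => #|A| <= n)) => //.
    by rewrite cards0.
  move=> A a B b leA leB; apply: leq_trans (leq_card_setU _ _) _.
  exact: leq_add.
apply: leq_sum => H /copyC[monoH [k _ copyH]].
by have := pad_copy_small freeG copyH monoH; case: (m).
Qed.

End Padding.

(** Union bound by counting: an injection [f] and a color [b] exclude a fraction
    [1 / 2 ^ #|edge_set G|] of all colorings, and there are at most [2 * #|V| ^ #|T|] such pairs. *)
Lemma ex_mono_free (T V : finType) (G : sgraph T) :
  2 * #|V| ^ #|T| < 2 ^ #|edge_set G| ->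
  exists chi : {set V} -> bool, mono_free G chi.
Proof.
move=> few; pose img (f : {ffun T -> V}) := [set f @: (e : {set T}) | e in edge_set G].
(* As a [family], the bad event has a product for its cardinality: a factor 1 for each set in
   [img f], a factor 2 for every other set. *)
pose allowed f (b : bool) e := if e \in img f then pred1 b else predT.
pose bad (p : {ffun T -> V} * bool) : {set {ffun {set V} -> bool}} :=
  [set chi in family (allowed p.1 p.2)].
pose I := [set p : {ffun T -> V} * bool | injectiveb p.1].
have card_bad p : p \in I -> #|bad p| * 2 ^ #|edge_set G| = 2 ^ #|{set V}|.
  case: p => f b; rewrite inE => /injectiveP injf.
  have cimg : #|img f| = #|edge_set G| by apply/card_imset/imset_inj.
  rewrite cardsE card_family -cimg -(cardC (mem (img f))) addnC expnD; congr (_ * _).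
  rewrite foldrE big_map big_enum /= (bigID (mem (img f))) /=.
  rewrite big1 ?mul1n => [|e ein]; last by rewrite /allowed ein card1.
  rewrite -prod_nat_const; apply: eq_bigr => e /negbTE eout.
  by rewrite /allowed eout card_bool.
have [/existsP[chi good]|] := boolP [exists chi, chi \notin \bigcup_(p in I) bad p].
  exists chi => H [f [injf _ H2]] [b monoH]; case/negP: good.
  apply/bigcupP; exists ([ffun x => f x], b).
    by rewrite inE; apply/injectiveP => x y; rewrite !ffunE => /injf.
  rewrite inE; apply/familyP => e; rewrite /allowed /=; case: ifP => // ein.
  rewrite inE; apply/eqP/monoH; rewrite H2; move: ein => /imsetP[d dG ->].
  by apply/imsetP; exists d => //; apply: eq_imset => x; rewrite ffunE.
rewrite negb_exists => /forallP allbad; exfalso.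
(* If the bad events covered all colorings, summing [card_bad] over [I] would force
   [2 ^ #|edge_set G| <= #|I|]. *)
have : 2 ^ #|{set V}| * 2 ^ #|edge_set G| <= #|I| * 2 ^ #|{set V}|.
  rewrite -sum_nat_const -(eq_bigr _ card_bad) -big_distrl leq_pmul2r ?expn_gt0 //=.
  rewrite -card_bool -card_ffun -cardsT.
  apply: leq_trans (_ : #|\bigcup_(p in I) bad p| <= _).
    by apply/subset_leq_card/subsetP => chi _; have := allbad chi; rewrite negbK.
  apply: (big_ind2 (fun (A : {set {ffun {set V} -> bool}}) n => #|A| <= n)) => //.
    by rewrite cards0.
  move=> A a B b leA leB; apply: leq_trans (leq_card_setU _ _) _.
  exact: leq_add.
rewrite mulnC leq_pmul2r ?expn_gt0 // leqNgt => /negP; apply.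
apply: leq_ltn_trans few; apply: leq_trans (max_card _) _.
by rewrite card_prod card_ffun card_bool mulnC.
Qed.

Section CompleteBipartite.
Variable D : nat.

Definition biclique_rel : rel 'I_(D + D) := fun x y => (x < D) != (y < D).

Lemma biclique_sym : symmetric biclique_rel.
Proof. by move=> x y; rewrite /biclique_rel eq_sym. Qed.

Lemma biclique_irr : irreflexive biclique_rel.
Proof. by move=> x; rewrite /biclique_rel eqxx. Qed.

Definition biclique := SGraph biclique_sym biclique_irr.

Lemma biclique_bipartite : bipartite biclique.
Proof. by exists (fun x : 'I_(D + D) => x < D). Qed.

Lemma biclique_max_degree : max_degree biclique <= D.
Proof.
apply/bigmax_leqP => x _; rewrite /degree /= /biclique_rel.
pose part (i : 'I_D) := if x < D then rshift D i else lshift D i.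
rewrite -[leqRHS]card_ord -cardsT; apply: leq_trans (leq_imset_card part _).
apply/subset_leq_card/subsetP => y; rewrite inE => xy.
apply/imsetP; rewrite /part; by case: (split_ordP y) xy => j ->; case: (x < D) => // _; exists j.
Qed.

Lemma biclique_edges : D * D <= #|edge_set biclique|.
Proof.
pose e (p : 'I_D * 'I_D) := [set lshift D p.1; rshift D p.2].
have inje : injective e.
  move=> [i j] [i' j'] /setP/[dup] /(_ (lshift D i)) + /(_ (rshift D j)).
  rewrite !inE /= !eqxx orbT /= eq_lshift eq_rshift eq_lrshift eq_rlshift orbF /=.
  by move=> /esym/eqP -> /esym/eqP ->.
rewrite -[X in X * X]card_ord -card_prod -cardsT -(card_imset _ inje).
apply/subset_leq_card/subsetP => _ /imsetP[[i j] _ ->].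
apply/imsetP; exists (lshift D i, rshift D j) => //.
by rewrite inE /= /biclique_rel /= ltn_ord ltnNge leq_addr.
Qed.

Lemma ex_biclique_free : 1 < D ->
  exists chi : {set 'I_(2 ^ D.-1./2)} -> bool, mono_free biclique chi.
Proof.
move=> D1; apply: ex_mono_free; rewrite !card_ord.
apply: leq_trans (leq_pexp2l _ biclique_edges) => //.
(* In exponents, [1 + 2 * D * D.-1./2 <= 1 + D * (D - 1) < D * D], the last step by [1 < D]. *)
rewrite -expnM -expnS ltn_exp2l //.
have := odd_double_half D.-1; case: (odd _); nia.
Qed.

End CompleteBipartite.

Definition two_edges_rel : rel 'I_4 := fun x y => (x != y) && (x./2 == y./2).

Lemma two_edges_sym : symmetric two_edges_rel.
Proof. by move=> x y; rewrite /two_edges_rel eq_sym (eq_sym x./2). Qed.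

Lemma two_edges_irr : irreflexive two_edges_rel.
Proof. by move=> x; rewrite /two_edges_rel eqxx. Qed.

Definition two_edges := SGraph two_edges_sym two_edges_irr.

Lemma two_edges_bipartite : bipartite two_edges.
Proof.
exists (fun x : 'I_4 => odd x) => x y /andP[neq /eqP half]; apply: contra neq => /eqP par.
by apply/eqP/val_inj; rewrite /= -(odd_double_half x) -(odd_double_half y) half par.
Qed.

Lemma two_edges_max_degree : max_degree two_edges <= 1.
Proof.
apply/bigmax_leqP => x _; apply/card_le1_eqP => y z.
have [side sideG] := two_edges_bipartite.
rewrite !inE => /andP[xy /eqP xy2] /andP[xz /eqP xz2]; apply/val_inj.
move: xy xz; rewrite -!val_eqE /=; lia.
Qed.

(** A copy spans all of ['I_4], so exactly one of its two disjoint edges contains the center [ord0]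
    of the star. *)
Lemma two_edges_star_free :
  mono_free two_edges (fun e : {set 'I_4} => ord0 \in e).
Proof.
move=> H [f [injf _ H2]] [b monoH].
have edge x y : two_edges x y -> (ord0 \in f @: [set x; y]) = b.
  move=> xy; apply: monoH; rewrite H2; apply: imset_f.
  by apply/imsetP; exists (x, y); rewrite ?inE.
have [g fK gK] := injF_bij injf.
have mem A : (ord0 \in f @: (A : {set _})) = (g ord0 \in A).
  by rewrite -{1}[ord0]gK mem_imset.
have := edge (inord 0) (inord 1); have := edge (inord 2) (inord 3).
rewrite !mem !inE /= /two_edges_rel -!val_eqE /= !inordK //= => <- // /(_ isT).
by case: (g ord0) => [[|[|[|[|]]]]].
Qed.

Definition edgeless T : sgraph T :=
  @SGraph T (fun _ _ => false) (fun _ _ => erefl) (fun _ => erefl).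

Lemma edgeless_max_degree (T : finType) : max_degree (edgeless T) <= 0.
Proof.
apply/bigmax_leqP => x _; rewrite /degree.
by rewrite (_ : [set _ | _] = set0) ?cards0 //; apply/setP => y; rewrite !inE.
Qed.

Lemma mono_free_card (T V : finType) (G : sgraph T) (chi : {set V} -> bool) :
  #|V| < #|T| -> mono_free G chi.
Proof. by move=> ltVT H [f [/leq_card + _ _]] _; rewrite leqNgt ltVT. Qed.

Lemma biclique_bound D : 32 <= D ->
  2 ^ (D %/ 32).+1 * (D + D).-1 <= 2 ^ D.-1./2.
Proof.
move=> D32; set q := D %/ 32.
have q1 : 0 < q by rewrite divn_gt0.
have Dlt : D < 32 * q.+1 by rewrite mulnC ltn_ceil.
have Dge : 32 * q <= D by rewrite mulnC leq_trunc_div.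
have hD : 16 * q - 1 <= D.-1./2 by lia.
(* Here [2 * D < 64 * q.+1 <= 2 ^ (6 + q)], and the total exponent [2 * q + 7] is at most
   [16 * q - 1] because [q >= 1]. *)
apply: leq_trans (_ : 2 ^ q.+1 * 2 ^ (6 + q) <= _).
  rewrite leq_pmul2l ?expn_gt0 // expnD.
  have := ltn_expl q (isT : 1 < 2); rewrite (_ : 2 ^ 6 = 64) //; lia.
rewrite -expnD leq_exp2l //; lia.
Qed.

(** The summand [0 < Delta] makes the exponent at least the real number [Delta / 32]. It vanishes at
    [Delta = 0], where all graphs are edgeless and a single copy covers any nonempty complete
    graph. *)
Lemma ex_covering_lower_bound Delta :
  exists F : graph_seq, bounded_seq Delta F /\ bipartite_seq F /\
    exists (n : nat) (chi : {set 'I_n} -> bool), forall C : {set subgraph 'I_n},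
      covering F chi C -> 2 ^ (Delta %/ 32 + (0 < Delta)) <= #|C|.
Proof.
have [D32|] := leqP 32 Delta.
  have [|chi free] := @ex_biclique_free Delta; first exact: leq_trans D32.
  exists (pad (biclique Delta)); split; first exact/pad_bounded/biclique_max_degree.
  split; first exact/pad_bipartite/biclique_bipartite.
  exists (2 ^ Delta.-1./2), chi => C /(pad_covering free).
  rewrite card_ord => /(leq_trans (biclique_bound D32)).
  rewrite (leq_trans _ D32) // addn1 leq_pmul2r //; lia.
case: Delta => [|Delta] D32.
  (* No copy of [edgeless 'I_2] fits in one vertex, so [pad_covering] with [m = 2] yields
     [1 <= #|C|]. *)
  exists (pad (edgeless 'I_2)); split; first exact/pad_bounded/edgeless_max_degree.
  split; first by apply/pad_bipartite; exists (fun _ => false).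
  exists 1, (fun _ => false) => C covC.
  have := pad_covering _ covC; rewrite card_ord muln1; apply.
  by apply: mono_free_card; rewrite !card_ord.
exists (pad two_edges); split.
  exact/pad_bounded/(leq_trans two_edges_max_degree).
split; first exact/pad_bipartite/two_edges_bipartite.
(* Copies have at most 3 vertices, so [4 <= #|C| * 3] forces two of them, as required for
   [0 < Delta < 32]. *)
exists 4, (fun e : {set 'I_4} => ord0 \in e) => C /(pad_covering two_edges_star_free).
by rewrite card_ord divn_small //= expn1; lia.
Qed.

Unset Implicit Arguments.
Local Open Scope ring_scope.

Theorem theorem3 (R : realType) :
  exists c : R, 0 < c /\
    forall Delta : nat,
      exists F : graph_seq,
        bounded_seq Delta F /\ bipartite_seq F /\
        exists (n : nat) (chi : {set 'I_n} -> bool),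
          forall C : {set subgraph 'I_n},
            covering F chi C -> 2 `^ (c * Delta%:R) <= #|C|%:R.
Proof.
exists 32%:R^-1; split; first by rewrite invr_gt0 ltr0n.
move=> Delta; have [F [bF [pF [n [chi bound]]]]] := ex_covering_lower_bound Delta.
exists F; do 2!split=> //; exists n, chi => C /bound le2.
apply: le_trans (_ : 2 ^+ (Delta %/ 32 + (0 < Delta)) <= _); last first.
  by rewrite -natrX ler_nat.
rewrite -powR_mulrn ?ler0n // ler_powR ?ler1n //.
rewrite mulrC ler_pdivrMr ?ltr0n // -natrM ler_nat.
(* Rounding: [Delta < 32 * (Delta %/ 32 + 1)]. *)
by case: posnP => [-> //|_]; rewrite addn1 ltnW // ltn_ceil.
Qed.
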